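(* Let $X$ be a sub-Gaussian random variable with parameter $\sigma>0$, and let $\rho:\mathcal{L}\to\mathbb{R}$ be a risk measure of type (T1) with parameters $L>0$ and $\kappa\in(0,1]$. Then, for every $n\ge1$ and every $\epsilon>0$ such that $\frac{512\sigma}{\sqrt n}<\left(\frac{\epsilon}{L}\right)^{1/\kappa}<\frac{512\sigma}{\sqrt n}+16\sigma\sqrt e$, $$\mathbb{P}\left(|\rho_n-\rho(X)|>\epsilon\right)\le\exp\left(-\frac{n}{256\,\sigma^2e}\left(\left(\frac{\epsilon}{L}\right)^{1/\kappa}-\frac{512\sigma}{\sqrt n}\right)^2\right),$$ where $e$ is Euler's number.
   Context: A random variable $X$ is sub-Gaussian with parameter $\sigma>0$ if $\mathbb{P}(X\ge\epsilon)\le\exp(-\epsilon^2/(2\sigma^2))$ and $\mathbb{P}(X\le-\epsilon)\le\exp(-\epsilon^2/(2\sigma^2))$ for every $\epsilon>0$ (mean zero is not required). $\mathcal{L}$ is the set of CDFs on $\mathbb{R}$. A risk measure is a map $\rho:\mathcal{L}\to\mathbb{R}$; if $X$ has CDF $F$, $\rho(X)$ means $\rho(F)$. A risk measure $\rho$ is of type (T1) with parameters $L>0$, $\kappa\in(0,1]$ if $|\rho(F)-\rho(G)|\le L\,(W_1(F,G))^\kappa$ for all $F,G\in\mathcal{L}$. $W_1$ is the 1-Wasserstein distance: $W_1(F_1,F_2)=\inf\int_{\mathbb{R}^2}|x-y|\,dF(x,y)$ over joint distributions $F$ with marginals $F_1,F_2$; equivalently $W_1(F_1,F_2)=\int_{-\infty}^{\infty}|F_1(s)-F_2(s)|\,ds$.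 Given i.i.d. samples $X_1,\dots,X_n$ from the distribution of $X$, $F_n(x)=\frac1n\sum_{i=1}^n\mathbf 1\{X_i\le x\}$ is the empirical distribution function, and $\rho_n=\rho(F_n)$. *)

(* Defs.v *)
From HB Require Import structures.
From mathcomp Require Import all_boot all_order all_algebra.
From mathcomp Require Import all_classical all_reals all_analysis.

Set Implicit Arguments.
Unset Strict Implicit.
Unset Printing Implicit Defensive.

Import Order.TTheory GRing.Theory Num.Theory.
Import numFieldNormedType.Exports.

Local Open Scope classical_set_scope.
Local Open Scope ring_scope.

(* Right-continuous nondecreasing functions with limits 0 at -oo and 1 at +oo. *)
Notation CDF R := (@cumulativeBounded R 0 1).

Section cdf_of_random_variable.
Context d (T : measurableType d) (R : realType) (P : probability T R).
Variable X : {RV P >-> R}.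

(* The library's cdf takes values in \bar R. *)
Definition rcdf (t : R) : R := fine (cdf X t).

Let rcdf_nd : nondecreasing rcdf.
Proof.
by move=> s t st; rewrite fine_le ?fin_num_measure// cdf_nondecreasing.
Qed.

Let rcdf_rc : right_continuous rcdf.
Proof.
move=> a; apply: fine_cvg.
by rewrite fineK ?fin_num_measure//; exact: cdf_right_continuous.
Qed.

HB.instance Definition _ := isCumulative.Build R _ R rcdf rcdf_nd rcdf_rc.

Let rcdf_Ny0 : rcdf @ -oo --> (0 : R).
Proof. exact/fine_cvg/cvg_cdfNy0. Qed.

Let rcdf_y1 : rcdf @ +oo --> (1 : R).
Proof. exact/fine_cvg/cvg_cdfy1. Qed.

HB.instance Definition _ :=
  isCumulativeBounded.Build R 0 1 rcdf rcdf_Ny0 rcdf_y1.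

End cdf_of_random_variable.

Section empirical_cdf.
Context (R : realType) (n : nat).

(* The unused positivity proof makes the CDF structure below inferable: for
   n = 0 the function is identically 0, hence not a CDF. *)
Definition ecdf (n_gt0 : (0 < n)%N) (x : 'I_n -> R) (t : R) : R :=
  n%:R^-1 * \sum_(i < n) ((x i <= t)%R)%:R.

Variables (n_gt0 : (0 < n)%N) (x : 'I_n -> R).

Let ecdf_nd : nondecreasing (ecdf n_gt0 x).
Proof.
move=> s t st; rewrite /ecdf ler_wpM2l ?invr_ge0// ler_sum// => i _.
by rewrite ler_nat; case: (leP (x i) s) => // /le_trans/(_ st) ->.
Qed.

Let step_cvg (F : set_system R) (FF : Filter F) (c : 'I_n -> bool) :
  (forall i, \forall t \near F, (x i <= t) = c i) ->
  ecdf n_gt0 x t @[t --> F] --> (n%:R^-1 * \sum_(i < n) (c i)%:R : R).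
Proof.
move=> xc; apply: cvg_near_cst.
have : \forall t \near F, forall i, (x i <= t) = c i by exact: filter_forall.
apply: filterS => t xct; rewrite /ecdf.
by congr (_ * _); apply: eq_bigr => i _; rewrite xct.
Qed.

Let ecdf_rc : right_continuous (ecdf n_gt0 x).
Proof.
move=> a; apply: step_cvg => i.
have [xa|ax] := leP (x i) a.
  by near=> t; rewrite (le_trans xa)//; near: t; exact: nbhs_right_ge.
by near=> t; apply/negbTE; rewrite -ltNge; near: t; exact: nbhs_right_lt.
Unshelve. all: by end_near. Qed.

HB.instance Definition _ :=
  isCumulative.Build R _ R (ecdf n_gt0 x) ecdf_nd ecdf_rc.

Let ecdf_Ny0 : ecdf n_gt0 x @ -oo --> (0 : R).
Proof.
have -> : (0 : R) = n%:R^-1 * \sum_(i < n) false%:R by rewrite big1 ?mulr0.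
apply: step_cvg => i.
by near=> t; apply/negbTE; rewrite -ltNge; near: t; apply: nbhs_ninfty_lt; exact: num_real.
Unshelve. all: by end_near. Qed.

Let ecdf_y1 : ecdf n_gt0 x @ +oo --> (1 : R).
Proof.
have -> : (1 : R) = n%:R^-1 * \sum_(i < n) true%:R.
  by rewrite sumr_const card_ord mulVf// pnatr_eq0 -lt0n.
apply: step_cvg => i.
by near=> t; near: t; apply: nbhs_pinfty_ge; exact: num_real.
Unshelve. all: by end_near. Qed.

HB.instance Definition _ :=
  isCumulativeBounded.Build R 0 1 (ecdf n_gt0 x) ecdf_Ny0 ecdf_y1.

End empirical_cdf.

Definition has_marginal_cdfs (R : realType) (F G : CDF R)
    (gamma : probability (R * R)%type R) : Prop :=
  forall t : R, gamma [set z | z.1 <= t] = (F t)%:E /\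
                gamma [set z | z.2 <= t] = (G t)%:E.

Definition wasserstein1 (R : realType) (F G : CDF R) : \bar R :=
  ereal_inf [set (\int[gamma]_z `|z.1 - z.2|%:E)%E |
             gamma in [set gamma | has_marginal_cdfs F G gamma]].

(* Since kappa > 0, the bound is vacuous when the distance is +oo. *)
Definition risk_type_T1 (R : realType) (rho : CDF R -> R) (L kappa : R) : Prop :=
  forall F G : CDF R,
    (`|rho F - rho G|%:E <= L%:E * wasserstein1 F G `^ kappa)%E.

Definition sub_gaussian d (T : measurableType d) (R : realType)
    (P : probability T R) (X : {RV P >-> R}) (sigma : R) : Prop :=
  forall eps : R, 0 < eps ->
    (P [set w | (eps <= X w)%R] <= (expR (- (eps ^+ 2 / (2 * sigma ^+ 2))))%:E)%E
    /\
    (P [set w | (X w <= - eps)%R] <= (expR (- (eps ^+ 2 / (2 * sigma ^+ 2))))%:E)%E.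

Definition independent_family d (T : measurableType d) (R : realType)
    (P : probability T R) (I : finType) (Y : I -> {RV P >-> R}) : Prop :=
  forall (J : {set I}) (B : I -> set R), (forall i, measurable (B i)) ->
    P (\bigcap_(i in [set` J]) (Y i @^-1` B i)) =
    (\prod_(i in J) P (Y i @^-1` B i))%E.

Definition same_distribution d (T : measurableType d) (R : realType)
    (P : probability T R) (X Y : {RV P >-> R}) : Prop :=
  forall B : set R, measurable B -> distribution P X B = distribution P Y B.

Definition iid_samples d (T : measurableType d) (R : realType)
    (P : probability T R) (X : {RV P >-> R}) n (Xs : 'I_n -> {RV P >-> R}) : Prop :=
  independent_family Xs /\ (forall i, same_distribution (Xs i) X).

(* Main.v *)
Require Import Defs.
From HB Require Import structures.
From mathcomp Require Import all_boot all_order all_algebra.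
From mathcomp Require Import all_classical all_reals all_analysis.
From mathcomp Require Import measurable_realfun ring lra.

Import Order.TTheory GRing.Theory Num.Theory.
Import numFieldNormedType.Exports.

Local Open Scope classical_set_scope.
Local Open Scope ring_scope.

(* W_1(F_n, F) is at most int |F_n - F| (quantile coupling), so it suffices to
   control this integral.  For a probability density w, Jensen's inequality gives
     exp (lambda int |F_n - F|) <= int w exp (lambda |F_n - F| / w),
   whose expectation is computed for each s separately: F_n(s) is a mean of
   Bernoulli variables of parameter F(s), so the expectation of the exponential
   at s is at most 2 exp (n q a^2 e^a), where a = lambda / (n w(s)) and
   q = min (F(s), 1 - F(s)) <= exp (- s^2 / (2 sigma^2)).  If w decays like s^-2,
   then a is quadratic in s, and as long as its coefficients are small (this is
   where the upper bound on eps enters) the Gaussian tail absorbs a^2 e^a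
   uniformly in s.  Markov's inequality concludes: the mean of int |F_n - F| is
   never needed, and the shift 512 sigma / sqrt n merely absorbs the factor 2. *)

(** * Step functions on the line *)

Lemma measurable_natr_ler {d} {T : measurableType d} {R : realType}
    (f g : T -> R) : measurable_fun setT f -> measurable_fun setT g ->
  measurable_fun setT (fun x => ((f x <= g x)%R)%:R : R).
Proof.
move=> mf mg.
rewrite (_ : (fun _ => _) = fun x => if f x <= g x then 1 else 0 : R).
  by apply: measurable_fun_ifT => //; exact: measurable_fun_ler.
by apply/funext => x; case: ifP.
Qed.

(** For [a <= b] the integrand is the indicator of [[a, b[]. Distances thus become integrals over a
    level [s], to which Tonelli applies. *)
Lemma integral_step_le {R : realType} (a b : R) :
  (\int[lebesgue_measure]_s `|((a <= s)%R)%:R - ((b <= s)%R)%:R|%:E =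
   `|a - b|%:E :> \bar R)%E.
Proof.
wlog ab : a b / a <= b.
  move=> H; have [/H//|/ltW/H ba] := leP a b.
  rewrite distrC -ba; apply: eq_integral => s _.
  by rewrite distrC.
transitivity (\int[lebesgue_measure]_s (\1_(`[a, b[%classic : set R) s)%:E)%E.
  apply: eq_integral => s _; congr EFin; rewrite indicE mem_setE in_itv/= ltNge.
  have [as_|sa] := leP a s; have [bs|sb] := leP b s => //=;
    rewrite ?subrr ?subr0 ?normr0 ?normr1//.
  by have := lt_le_trans sa ab; rewrite ltNge bs.
rewrite integral_indic// setIT /= lebesgue_measure_itv/= lte_fin
  ler0_norm ?subr_le0// opprB.
case: ltP => [//|ba]; have -> : a = b by apply/le_anti/andP.
by rewrite subrr.
Qed.

(** Companion with [s] as the moving point and [a], [b] as thresholds: the form needed once the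
    uniform variable is integrated first. *)
Lemma integral_step_ge {R : realType} (a b : R) :
  (\int[lebesgue_measure]_s `|((s <= a)%R)%:R - ((s <= b)%R)%:R|%:E =
   `|a - b|%:E :> \bar R)%E.
Proof.
wlog ab : a b / a <= b.
  move=> H; have [/H//|/ltW/H ba] := leP a b.
  rewrite distrC -ba; apply: eq_integral => s _.
  by rewrite distrC.
transitivity (\int[lebesgue_measure]_s (\1_(`]a, b]%classic : set R) s)%:E)%E.
  apply: eq_integral => s _; congr EFin; rewrite indicE mem_setE in_itv/= ltNge.
  have [as_|sa] := leP s a; have [bs|sb] := leP s b => //=;
    rewrite ?subrr ?sub0r ?normrN ?normr0 ?normr1//.
  by have := le_lt_trans as_ (le_lt_trans ab sb); rewrite ltxx.
rewrite integral_indic// setIT /= lebesgue_measure_itv/= lte_fin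
  ler0_norm ?subr_le0// opprB.
case: ltP => [//|ba]; have -> : a = b by apply/le_anti/andP.
by rewrite subrr.
Qed.

(** * Quantile coupling and the Wasserstein distance *)

(* The value 0 outside ]0, 1[ does not depend on F, so the quantile coupling
   costs nothing there. *)
Definition quantile {R : realType} (F : CDF R) (u : R) : R :=
  if 0 < u < 1 then inf [set s | u <= F s] else 0.

(** Galois connection. Every [t] to the right of the infimum satisfies [u <= F t] by monotonicity,
    and right continuity carries this down to [s]. *)
Lemma quantile_le {R : realType} (F : CDF R) (u s : R) : 0 < u < 1 ->
  (quantile F u <= s) = (u <= F s).
Proof.
move=> u01; rewrite /quantile u01; case/andP: u01 => u0 u1.
have lb : has_lbound [set s | u <= F s].
  have /(_ u u0) := [elaborate (cvgr_lt 0 (@cumulativeNy R 0 1 F))].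
  case=> M [_ HM]; exists M => t /= ut; rewrite leNgt; apply/negP => /HM.
  by rewrite ltNge ut.
have ne : [set s | u <= F s] !=set0.
  have /(_ u u1) := [elaborate (cvgr_gt 1 (@cumulativey R 0 1 F))].
  case=> M [_ HM]; exists (M + 1); apply/ltW/HM; rewrite ltrDl//.
apply/idP/idP; last by move=> us; apply: ge_inf.
move=> qs.
have step t : inf [set s | u <= F s] < t -> u <= F t.
  move=> qt.
  have [v /= uv vt] := inf_lt ne qt.
  by apply: (le_trans uv); apply: cumulative_is_nondecreasing; exact: ltW.
have rc := @cumulative_is_right_continuous _ _ _ F s.
apply: (@cvgr_to_ge _ _ _ _ _ _ u rc).
by near=> t; apply: step; apply: (le_lt_trans qs); near: t; exact: nbhs_right_gt.
Unshelve. all: by end_near. Qed.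

Lemma measurable_quantile {R : realType} (F : CDF R) :
  measurable_fun setT (quantile F).
Proof.
apply: (measurability (@RGenOInfty.G R)) => [|/= _ [_] [s] -> <-].
  exact: RGenOInfty.measurableE.
rewrite (_ : _ `&` _ = (`]0, 1[ `&` `]F s, +oo[) `|`
    (~` `]0, 1[ `&` [set _ | s < 0]))%classic.
  apply: measurableU; apply: measurableI => //; first exact: measurableC.
  have [s0|s0] := boolP (s < 0).
    by rewrite (_ : mkset _ = setT) //; apply/seteqP; split.
  by rewrite (_ : mkset _ = set0) //; apply/seteqP; split.
apply/seteqP; split => [u [_]|u] /=; rewrite !in_itv/= ?andbT.
  have [u01|u01] := boolP (0 < u < 1).
    by rewrite ltNge quantile_le// -ltNge; left.
  by rewrite /quantile (negbTE u01); right.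
case=> [[u01]|[/negP u01 s0]]; first by rewrite !ltNge quantile_le.
by split => //; rewrite /quantile (negbTE u01).
Qed.

(** Passes from the closed support of the uniform law to []0, 1[], where [quantile_le] applies; the
    two endpoints are null. *)
Lemma uniform_prob01 {R : realType} (A : set R) : measurable A ->
  uniform_prob (@ltr01 R) A = lebesgue_measure (A `&` `]0, 1[%classic).
Proof.
move=> mA.
have mI : measurable (A `&` `]0, 1[%classic) by exact: measurableI.
transitivity (lebesgue_measure (A `&` `[0, 1]%classic)).
  rewrite /uniform_prob integral_uniform_pdf.
  transitivity (\int[lebesgue_measure]_(x in A `&` `[0%R, 1%R]) (1 : \bar R))%E.
    apply: eq_integral => x; rewrite inE/= in_itv/= => -[_ x01].
    by rewrite /uniform_pdf x01 subr0 invr1.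
  by rewrite integral_cst ?mul1e//; exact: measurableI.
apply/le_anti/andP; split; last first.
  apply: le_measure; rewrite ?inE//; first exact: measurableI.
  by apply: setIS => x /=; rewrite !in_itv/= => /andP[/ltW -> /ltW ->].
have -> : lebesgue_measure (A `&` `]0%R, 1%R[%classic) =
    (lebesgue_measure (A `&` `]0%R, 1%R[%classic) +
     (lebesgue_measure [set 0%R : R] + lebesgue_measure [set 1%R : R]))%E.
  by rewrite !lebesgue_measure_set1 !adde0.
rewrite (le_trans _ (leeD2l _ (measureU2 _ _ _)))//.
rewrite (le_trans _ (measureU2 _ _ _))//; last exact: measurableU.
apply: le_measure; rewrite ?inE//; [exact: measurableI| |].
  by apply: measurableU => //; exact: measurableU.
move=> x /= [Ax]; rewrite !in_itv/= !le_eqVlt => /andP[].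
move=> /predU1P[<-|x0]; first by right; left.
move=> /predU1P[->|x1]; first by right; right.
by left; split => //; rewrite x0.
Qed.

Lemma cdf_bounds {R : realType} (F : CDF R) (s : R) : 0 <= F s <= 1.
Proof.
apply/andP; split.
  apply: (cvgr_to_le (@cumulativeNy R 0 1 F)).
  near=> t; apply: cumulative_is_nondecreasing; near: t.
  by apply: nbhs_ninfty_le; exact: num_real.
apply: (cvgr_to_ge (@cumulativey R 0 1 F)).
near=> t; apply: cumulative_is_nondecreasing; near: t.
by apply: nbhs_pinfty_ge; exact: num_real.
Unshelve. all: by end_near. Qed.

Lemma measurable_cdf {R : realType} (F : CDF R) : measurable_fun setT F.
Proof.
apply: nondecreasing_measurable => // x y xy.
exact: cumulative_is_nondecreasing.
Qed.

Lemma uniform_quantile_le {R : realType} (F : CDF R) (s : R) :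
  uniform_prob (@ltr01 R) [set u | quantile F u <= s] = (F s)%:E.
Proof.
have mq := measurable_quantile F.
rewrite uniform_prob01; last first.
  rewrite -[X in measurable X]setTI.
  have := mq measurableT `]-oo, s]%classic (measurable_itv _).
  by rewrite set_itvNyc.
have /andP[F0 F1] := cdf_bounds F s.
(* The set is []0, F s]], except that [u < 1] opens the right end when [F s = 1]. *)
rewrite (_ : _ `&` _ = [set` Interval (BRight 0) (BSide (F s == 1) (F s))]).
  rewrite lebesgue_measure_itv/= lte_fin sube0; case: ltP => // F0'.
  by congr EFin; apply/le_anti/andP.
apply/seteqP; split => [u [/= + u01]|u]; rewrite ?in_itv/=.
  move: u01; rewrite in_itv/= => /[dup] u01 /andP[u0 u1].
  rewrite quantile_le// u0 /=.
  by case: eqP => [->|_] //=; rewrite u1.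
move: (u : R) => {}u; rewrite !in_itv/= => /andP[u0 uF].
have uFs : u <= F s by exact: lteifW uF.
have u1 : u < 1.
  by case: eqP uF => [->//|/eqP Fn1 _]; rewrite (le_lt_trans uFs)// lt_neqAle Fn1.
by rewrite quantile_le u0 u1.
Qed.

(** The quantiles of a single uniform variable form a coupling. Its cost is written as a double
    integral of steps over [u] and [s]; after Tonelli, the integral over [u] at fixed [s] is at most
    [|F s - G s|]. *)
Lemma wasserstein1_le_integral {R : realType} (F G : CDF R) :
  (wasserstein1 F G <= \int[lebesgue_measure]_s `|F s - G s|%:E)%E.
Proof.
pose q (u : R) := (quantile F u, quantile G u).
have mq : measurable_fun setT q.
  by apply/measurable_fun_pairP; split; exact: measurable_quantile.
pose U : probability (measurableTypeR R) R := uniform_prob (@ltr01 R).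
pose Q : {RV U >-> (R * R)%type} :=
  @mfun_Sub _ _ (measurableTypeR R) (R * R)%type q (mem_set mq).
apply: (@le_trans _ _ (\int[distribution U Q]_z `|z.1 - z.2|%:E)%E).
  apply: ereal_inf_lbound; exists (distribution U Q) => // s; split.
    exact: uniform_quantile_le.
  exact: uniform_quantile_le.
have mabs : measurable_fun setT (fun z : R * R => `|z.1 - z.2|%:E).
  apply/measurable_EFinP; apply: measurableT_comp => //.
  by apply: measurable_funB.
rewrite ge0_integral_distribution//=.
(* The step integrand with [quantile F u <= s] turned into [u <= F s], which is jointly measurable
   in [(u, s)] and easy to integrate in [u]. *)
pose f (z : R * R) := `|((z.1 <= F z.2)%R)%:R - ((z.1 <= G z.2)%R)%:R|%:E : \bar R.
have mf : measurable_fun setT f.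
  apply/measurable_EFinP; apply: measurableT_comp => //.
  by apply: measurable_funB; apply: measurable_natr_ler => //;
    apply: measurableT_comp => //; exact: measurable_cdf.
have f0 z : (0 <= f z)%E by rewrite lee_fin.
apply: (@le_trans _ _ (\int[U]_u \int[lebesgue_measure]_s f (u, s))%E).
  apply: ge0_le_integral => //.
  - exact: (measurableT_comp mabs mq).
  - exact: (@measurable_fun_fubini_tonelli_F _ _ (measurableTypeR R)
      (measurableTypeR R) R lebesgue_measure f mf f0).
  move=> u _ /=.
  have [u01|u01] := boolP (0 < u < 1); last first.
    by rewrite /quantile (negbTE u01) subrr normr0 integral_ge0.
  rewrite -integral_step_le le_eqVlt; apply/orP; left; apply/eqP.
  by apply: eq_integral => s _; rewrite !quantile_le.
rewrite fubini_tonelli//; apply: ge0_le_integral => //.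
- by move=> s _; exact: integral_ge0.
- exact: (@measurable_fun_fubini_tonelli_G _ _ (measurableTypeR R)
    (measurableTypeR R) R U f mf f0).
- apply/measurable_EFinP; apply: measurableT_comp => //.
  by apply: measurable_funB; exact: measurable_cdf.
move=> s _.
have mfs : measurable_fun setT (fun u : R => f (u, s)).
  apply/measurable_EFinP; apply: measurableT_comp => //=.
  by apply: measurable_funB; exact: measurable_natr_ler.
rewrite integral_uniform//.
rewrite subr0 invr1 mul1e -integral_step_ge.
(* Extending the nonnegative integrand from [[0, 1]] to the whole line can only increase the
   integral. *)
exact: ge0_subset_integral.
Qed.

(** * From the risk measure to the L1 distance of CDFs *)

(** By contraposition: an integral of at most [(eps / L) ^ (1 / kappa)] bounds the Wasserstein
    distance as well, and [L z ^ kappa] is increasing in [z]. It serves both the deviation event and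
    its measurability. *)
Lemma risk_type_T1_gap {R : realType} (rho : CDF R -> R) (L kappa : R)
    (F G : CDF R) (eps : R) :
  0 < L -> 0 < kappa -> risk_type_T1 rho L kappa -> 0 < eps ->
  eps < `|rho F - rho G| ->
  (((eps / L) `^ kappa^-1)%:E < \int[lebesgue_measure]_s `|F s - G s|%:E)%E.
Proof.
move=> L0 k0 rhoT e0; rewrite -lte_fin; apply: contraTT; rewrite -!leNgt => FG.
have W0 : (0 <= wasserstein1 F G)%E.
  by apply: le_ereal_inf_tmp => _ [gamma _ <-]; exact: integral_ge0.
apply: (le_trans (rhoT F G)).
rewrite -[leRHS](_ : L%:E * ((eps / L) `^ kappa^-1)%:E `^ kappa = _)%E.
  rewrite lee_pmul2l//; apply: (gt0_ler_poweR (ltW k0)).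
  - by rewrite in_itv/= W0 leey.
  - by rewrite in_itv/= lee_fin powR_ge0 leey.
  - exact: le_trans (wasserstein1_le_integral F G) FG.
rewrite poweR_EFin -powRrM mulVf ?gt_eqF// powRr1 ?divr_ge0 ?ltW//.
by rewrite -EFinM mulrC divfK// gt_eqF.
Qed.

(** Triangle inequality, one step function per sample point. The empirical CDF is thus Lipschitz in
    the sample for the L1 distance. *)
Lemma integral_ecdf_sub {R : realType} (n : nat) (n_gt0 : (0 < n)%N)
    (x y : 'I_n -> R) :
  (\int[lebesgue_measure]_s `|ecdf n_gt0 x s - ecdf n_gt0 y s|%:E <=
   (n%:R^-1 * \sum_(i < n) `|x i - y i|)%:E)%E.
Proof.
have mstep i : measurable_fun setT
    (fun s : R => `|((x i <= s)%R)%:R - ((y i <= s)%R)%:R|%:E : \bar R).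
  apply/measurable_EFinP; apply: measurableT_comp => //.
  by apply: measurable_funB; exact: measurable_natr_ler.
have msum := emeasurable_sum (index_enum 'I_n) mstep.
rewrite EFinM -sumEFin.
under eq_bigr do rewrite -integral_step_le.
rewrite -ge0_integral_sum//.
rewrite -ge0_integralZl//; last by move=> s _; exact: sume_ge0.
apply: ge0_le_integral => //.
- apply/measurable_EFinP; apply: measurableT_comp => //.
  by apply: measurable_funB; exact: measurable_cdf.
- exact: emeasurable_funM.
move=> s _; rewrite sumEFin -EFinM lee_fin /ecdf -mulrBr normrM.
rewrite ger0_norm ?invr_ge0//.
by rewrite ler_wpM2l ?invr_ge0// -sumrB ler_norm_sum.
Qed.

Lemma measurable_open_preimage {d} {T : measurableType d} {R : realType}
    (n : nat) (X : 'I_n -> T -> R) (A : set ('I_n -> R)) :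
  (forall i, measurable_fun setT (X i)) ->
  (forall x, A x -> exists2 r : R, 0 < r &
    forall y, (forall i, `|x i - y i| < r) -> A y) ->
  measurable [set w | A (X ^~ w)].
Proof.
move=> mX oA.
(* An open set is the union of the rational boxes it contains. *)
pose box (q : {ffun 'I_n -> rat} * rat) (x : 'I_n -> R) :=
  forall i, `|ratr (q.1 i) - x i| < ratr q.2.
pose U q := [set w | box q (X ^~ w) /\ box q `<=` A].
rewrite (_ : [set w | _] = \bigcup_q U q).
  apply: countable_bigcupT_measurable => // q.
  have [qA|qA] := pselect (box q `<=` A); last first.
    by rewrite (_ : U q = set0)//; apply/seteqP; split => // w [].
  rewrite (_ : U q = \bigcap_(i in [set: 'I_n])
      (X i @^-1` `](ratr (q.1 i) - ratr q.2), (ratr (q.1 i) + ratr q.2)[%classic)).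
    apply: fin_bigcap_measurable => // i _.
    by rewrite -[X in measurable X]setTI; exact: mX.
  apply/seteqP; split => [w [qw _] i _|w qw] /=.
    by have := qw i; rewrite in_itv/= distrC ltr_distl.
  by split => // i; have := qw i I; rewrite /= in_itv/= distrC ltr_distl.
apply/seteqP; split => [w Aw|w [q _ [qw /(_ _ qw)]]//].
have [r r0 rA] := oA _ Aw.
(* With a radius below [r / 2], every point of a box containing the sample is within [r] of it. *)
have [e] := @rat_in_itvoo R 0 (r / 2) (divr_gt0 r0 (ltr0n _ 2)).
rewrite in_itv/= => /andP[e0 er].
have /choice[q qX] : forall i, exists q : rat, `|ratr q - X i w| < ratr e :> R.
  move=> i.
  have : X i w - ratr e < X i w + ratr e by rewrite ltrD2l gtrN.
  by move=> /rat_in_itvoo[q]; rewrite in_itv/= => qX; exists q; rewrite ltr_distl.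
exists ([ffun i => q i], e) => //; split => [i|y qy]; first by rewrite /= ffunE.
apply: rA => i; have := qy i; rewrite /= ffunE => qyi.
have := ler_distD (ratr (q i)) (X i w) (y i).
have := qX i; rewrite [X in X < _]distrC; lra.
Qed.

(* A measure is monotone on measurable sets only, and nothing is assumed on rho
   but (T1), which makes it continuous in the sample. *)
Lemma measurable_risk_gap {d} {T : measurableType d} {R : realType}
    (rho : CDF R -> R) (L kappa : R) (F : CDF R) (eps : R)
    (n : nat) (n_gt0 : (0 < n)%N) (X : 'I_n -> T -> R) :
  0 < L -> 0 < kappa -> risk_type_T1 rho L kappa ->
  (forall i, measurable_fun setT (X i)) ->
  measurable [set w | eps < `|rho (ecdf n_gt0 (X ^~ w)) - rho F|].
Proof.
move=> L0 k0 rhoT mX.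
apply: (@measurable_open_preimage _ _ _ _ _
  [set x | eps < `|rho (ecdf n_gt0 x) - rho F|]) => //.
move=> x /= ex.
set c := `|rho (ecdf n_gt0 x) - rho F| - eps.
have c0 : 0 < c by rewrite subr_gt0.
(* By [risk_type_T1_gap], moving each sample point by less than this radius changes [rho] by at most
   [c / 2], half of the available slack. *)
exists ((c / 2 / L) `^ kappa^-1) => [|y xy].
  by rewrite powR_gt0// !divr_gt0.
suff : `|rho (ecdf n_gt0 x) - rho (ecdf n_gt0 y)| <= c / 2.
  have := ler_distD (rho (ecdf n_gt0 y)) (rho (ecdf n_gt0 x)) (rho F).
  rewrite /c; move: ex; rewrite /=; lra.
rewrite leNgt; apply/negP =>
  /(risk_type_T1_gap _ _ _ _ _ _ L0 k0 rhoT (divr_gt0 c0 (ltr0n _ 2))).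
apply/negP; rewrite -leNgt (le_trans (integral_ecdf_sub _ _ _ _))// lee_fin.
rewrite ler_pdivrMl ?ltr0n// mulr_natl -[n in leRHS]card_ord -sumr_const.
by apply: ler_sum => i _; exact/ltW.
Qed.

(** * Exponential moments of centred indicators *)

(** Independence is a statement about intersections of events, so the product is expanded over
    subsets: each term is a constant times the indicator of such an intersection. In the expansion
    [J] collects the factors 1, hence the events are those of [~: J]. *)
Lemma integral_prod_independent {d} {T : measurableType d} {R : realType}
    (P : probability T R) (I : finType) (Y : I -> {RV P >-> R})
    (B : I -> set R) (theta p : I -> R) :
  independent_family Y -> (forall i, measurable (B i)) ->
  (forall i, 0 <= theta i) -> (forall i, P (Y i @^-1` B i) = (p i)%:E) ->
  (\int[P]_w (\prod_i (1 + theta i * \1_(B i) (Y i w)))%:E =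
   (\prod_i (1 + theta i * p i))%:E)%E.
Proof.
move=> indep mB th0 Pp.
have distr (F : I -> R) : \prod_i (1 + F i) =
    \sum_(J : {set I}) \prod_i (if i \in J then 1 else F i).
  by rewrite bigA_distr; apply: eq_bigl => J; rewrite inE.
have mprod (J : {set I}) : measurable_fun setT (fun w =>
    \prod_i (if i \in J then 1 else theta i * \1_(B i) (Y i w))).
  apply: measurable_prod => i _; case: (i \in J) => //.
  apply: measurable_funM => //.
  by apply: measurableT_comp => //; exact: measurable_indic.
transitivity (\int[P]_w \sum_(J : {set I})
    (\prod_i (if i \in J then 1 else theta i * \1_(B i) (Y i w)))%:E)%E.
  by apply: eq_integral => w _; rewrite sumEFin -distr.
rewrite ge0_integral_sum//; last 2 first.
- by move=> J; exact/measurable_EFinP.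
- move=> J w _; rewrite lee_fin prodr_ge0// => i _; case: (i \in J) => //.
  by rewrite mulr_ge0// indicE.
rewrite (distr (fun i => theta i * p i)) -sumEFin; apply: eq_bigr => J _.
have mI : measurable (\bigcap_(i in [set` ~: J]) (Y i @^-1` B i)).
  apply: fin_bigcap_measurable => // i _.
  by rewrite -[X in measurable X]setTI; exact: (measurable_funP (Y i)).
transitivity (\int[P]_w ((\prod_(i in ~: J) theta i)%:E *
    (\1_(\bigcap_(i in [set` ~: J]) (Y i @^-1` B i)) w)%:E))%E.
  apply: eq_integral => w _; rewrite -EFinM; congr EFin.
  rewrite (bigID (mem J))/= big1 ?mul1r; last by move=> i ->.
  rewrite (eq_bigl [in ~: J]); last by move=> i; rewrite inE.
  rewrite (eq_bigr (fun i => theta i * \1_(B i) (Y i w))); last first.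
    by move=> i; rewrite inE => /negbTE ->.
  rewrite big_split/=; congr (_ * _).
  have [wJ|] := pselect (forall i, i \in ~: J -> B i (Y i w)).
    rewrite big1 => [|i iJ]; first by rewrite indicE mem_set.
    by rewrite indicE mem_set//; exact: wJ.
  move=> /existsNP[i /not_implyP[iJ wi]].
  rewrite (bigD1 i)//= indicE memNset// mul0r indicE memNset// => H.
  by apply: wi; exact: H.
rewrite ge0_integralZl//; last 2 first.
- by apply/measurable_EFinP; exact: measurable_indic.
- by rewrite lee_fin prodr_ge0.
rewrite integral_indic// setIT [X in (_ * X)%E](indep (~: J) B mB).
rewrite (eq_bigr (fun i => (p i)%:E)) => [|i _]; last exact: Pp.
rewrite prodEFin -EFinM -big_split/=; congr EFin.
rewrite [RHS](bigID (mem J))/= [in RHS]big1 ?mul1r; last by move=> i ->.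
apply: eq_big => [i|i]; first by rewrite inE.
by rewrite inE => /negbTE ->.
Qed.

(** The inequality [1 + x <= expR x] is applied around the rarer of the two outcomes, which produces
    the minimum. The exponents are [p (e^a - 1 - a)] and [(1 - p) (a - 1 + e^(-a))]. *)
Lemma bernoulli_mgf_le {R : realType} (p a : R) : 0 <= p <= 1 -> 0 <= a ->
  expR (- (a * p)) * (1 + (expR a - 1) * p) <=
  expR (Num.min p (1 - p) * (a ^+ 2 * expR a)).
Proof.
move=> /andP[p0 p1] a0.
have ea1 : 1 <= expR a by rewrite -expR0 ler_expR.
have eN : expR (- a) * expR a = 1 by rewrite -expRD addNr expR0.
have [pq|pq] := leP p (1 - p).
  apply: (@le_trans _ _ (expR (- (a * p)) * expR ((expR a - 1) * p))).
    by rewrite ler_wpM2l ?expR_ge0// expR_ge1Dx.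
  rewrite -expRD ler_expR -subr_ge0.
  rewrite (_ : _ - _ = p * (expR a * (a ^+ 2 - 1 + expR (- a) * (1 + a)))); last first.
    transitivity (p * (a ^+ 2 * expR a - expR a + expR (- a) * expR a * (1 + a))).
      by rewrite eN; ring.
    by ring.
  rewrite !mulr_ge0 ?expR_ge0//.
  (* From [1 - a <= expR (- a)] follows [1 - a ^+ 2 <= expR (- a) * (1 + a)]. *)
  have := expR_ge1Dx (- a); nra.
rewrite (_ : 1 + _ = expR a * (1 - (1 - p) * (1 - expR (- a)))); last first.
  transitivity (expR a - (1 - p) * (expR a - expR (- a) * expR a)); last by ring.
  by rewrite eN; ring.
rewrite mulrA -expRD.
apply: (@le_trans _ _ (expR (- (a * p) + a) * expR (- ((1 - p) * (1 - expR (- a)))))).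
  by rewrite ler_wpM2l ?expR_ge0// expR_ge1Dx.
rewrite -expRD ler_expR.
rewrite [leLHS](_ : _ = (1 - p) * (a - 1 + expR (- a))); last by ring.
rewrite ler_wpM2l ?subr_ge0//.
apply: (@le_trans _ _ (a ^+ 2)); last by rewrite ler_peMr ?sqr_ge0.
(* Then [a - 1 + expR (- a)] is at most [a ^+ 2 / (1 + a)]. *)
have h : expR (- a) * (1 + a) <= 1.
  by rewrite -[leRHS]eN ler_wpM2l ?expR_ge0// expR_ge1Dx.
have := expR_gt0 (- a); nra.
Qed.

Lemma integral_expR_sum_le {d} {T : measurableType d} {R : realType}
    (P : probability T R) (n : nat) (Y : 'I_n -> {RV P >-> R})
    (B : set R) (p q a : R) :
  independent_family Y -> measurable B -> 0 <= a ->
  (forall i, P (Y i @^-1` B) = p%:E) -> 0 <= p <= 1 -> Num.min p (1 - p) <= q ->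
  (\int[P]_w (expR (a * (\sum_i (\1_B (Y i w) - p))))%:E <=
   (expR (n%:R * (q * (a ^+ 2 * expR a))))%:E)%E.
Proof.
move=> indep mB a0 Pp p01 pq.
have th0 : 0 <= expR a - 1 by rewrite subr_ge0 -expR0 ler_expR.
(* An indicator takes only the values 0 and 1, so its exponential is affine in it:
   [e^(a 1_B) = 1 + (e^a - 1) 1_B]. *)
have E w : expR (a * (\sum_i (\1_B (Y i w) - p))) =
    expR (- (a * p)) ^+ n * \prod_i (1 + (expR a - 1) * \1_B (Y i w)).
  rewrite mulr_sumr expR_sum.
  have -> : expR (- (a * p)) ^+ n = \prod_(i < n) expR (- (a * p)).
    by rewrite prodr_const card_ord.
  rewrite -big_split/=.
  apply: eq_bigr => i _; rewrite mulrBr expRD mulrC; congr (_ * _).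
  by rewrite indicE; case: (_ \in _); rewrite ?mulr1 ?mulr0 ?expR0; ring.
under eq_integral do rewrite E EFinM.
rewrite ge0_integralZl//; last 2 first.
- apply/measurable_EFinP; apply: measurable_prod => i _.
  apply: measurable_funD => //; apply: measurable_funM => //.
  by apply: measurableT_comp => //; exact: measurable_indic.
- by move=> w _; rewrite lee_fin prodr_ge0//.
rewrite (integral_prod_independent P _ Y (fun=> B) (fun=> expR a - 1) (fun=> p))//.
rewrite -EFinM lee_fin prodr_const card_ord -exprMn.
apply: (le_trans (lerXn2r n _ _ (bernoulli_mgf_le p a p01 a0))).
- rewrite nnegrE mulr_ge0 ?expR_ge0// addr_ge0// mulr_ge0//.
  by case/andP: p01.
- by rewrite nnegrE expR_ge0.
rewrite -expRM_natl ler_expR ler_wpM2l// ler_wpM2r//.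
by rewrite mulr_ge0 ?sqr_ge0 ?expR_ge0.
Qed.

(** * A heavy-tailed density and Jensen's inequality *)

(** The factor [c / 2] normalises the total mass to 1, and [c] is a length scale, later
    [2 * sigma]. *)
Definition weight {R : realType} (c s : R) : R := c / 2 / (c + `|s|) ^+ 2.

Lemma weight_gt0 {R : realType} (c s : R) : 0 < c -> 0 < weight c s.
Proof. by move=> c0; rewrite divr_gt0// ?exprn_gt0// ?divr_gt0// ltr_wpDr. Qed.

Lemma continuous_weight {R : realType} (c : R) : 0 < c -> continuous (weight c).
Proof.
move=> c0 s; apply: cvgM; first exact: cvg_cst.
apply: cvgV; first by rewrite gt_eqF// exprn_gt0// ltr_wpDr.
apply: (@cvg_comp _ _ _ _ (fun x : R => x ^+ 2)); last exact: exprn_continuous.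
by apply: cvgD; [exact: cvg_cst|exact: norm_continuous].
Qed.

Lemma integral_weight {R : realType} (c : R) : 0 < c ->
  (\int[lebesgue_measure]_s (weight c s)%:E = 1)%E.
Proof.
move=> c0.
rewrite ge0_symfun_integralT; last 3 first.
- by move=> s; exact/ltW/weight_gt0.
- exact: continuous_weight.
- by move=> s; rewrite /weight/= normrN.
rewrite -set_itvcy.
(* Antiderivative of the weight on the positive half-line, rising from [- 1 / 2] at 0 to 0 at
   infinity; symmetry doubles the mass. *)
pose F (s : R) : R := - (c / 2) / (c + s).
have cs (s : R) : 0 <= s -> c + s != 0 by move=> s0; rewrite gt_eqF// ltr_wpDr.
have dF (s : R) : 0 < s -> is_derive s 1 F (weight c s).
  move=> s0.
  have := cs s (ltW s0) => css.
  rewrite /F; apply: is_derive_eq.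
  rewrite /weight gtr0_norm//= /GRing.scale/=.
  by field.
rewrite (@ge0_continuous_FTC2y _ _ F _ 0).
- rewrite /F addr0 sub0e -EFinN -EFinM; congr EFin.
  by field; rewrite gt_eqF.
- by move=> s _; exact/ltW/weight_gt0.
- by apply: continuous_subspaceT; exact: continuous_weight.
- rewrite /F -[X in _ --> X](mulr0 (- (c / 2))); apply: cvgM; first exact: cvg_cst.
  apply/gtr0_cvgV0; last exact: cvg_addrl.
  by near=> s; rewrite ltr_wpDr.
- by move=> s s0; exact: (@ex_derive _ _ _ _ _ _ _ (dF s s0)).
- apply: cvg_at_right_filter; apply: cvgM; first exact: cvg_cst.
  apply: cvgV; first exact: cs.
  by apply: cvgD; [exact: cvg_cst|exact: cvg_id].
- move=> s; rewrite in_itv/= andbT => s0.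
  by rewrite derive1E; exact: (@derive_val _ _ _ _ _ _ _ (dF s s0)).
Unshelve. all: by end_near. Qed.

(** Jensen's inequality for [lambda * h / w] under the density [w]. Stating it for a real lower
    bound [tau] of the integral of [h] allows that integral to be infinite. *)
Lemma expR_le_integral_weight {R : realType} (w h : R -> R) (lambda tau : R) :
  measurable_fun setT w -> measurable_fun setT (fun s => (w s)^-1) ->
  measurable_fun setT h ->
  (forall s, 0 < w s) -> (forall s, 0 <= h s) -> 0 <= lambda -> 0 <= tau ->
  (\int[lebesgue_measure]_s (w s)%:E = 1)%E ->
  (tau%:E <= \int[lebesgue_measure]_s (h s)%:E)%E ->
  ((expR (lambda * tau))%:E <=
   \int[lebesgue_measure]_s (w s * expR (lambda * h s / w s))%:E)%E.
Proof.
move=> mw mwV mh w0 h0 l0 t0 w1 ht.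
set k := expR (lambda * tau).
have k0 : 0 <= k by exact: expR_ge0.
have mwe : measurable_fun setT (fun s => w s * expR (lambda * h s / w s)).
  apply: measurable_funM => //; apply: measurableT_comp => //.
  by apply: measurable_funM => //; exact: measurable_funM.
(* The tangent inequality of expR at lambda * tau, times w; the negative term is
   moved to the right so that all integrands are nonnegative. *)
have lin : (\int[lebesgue_measure]_s (w s * k + k * lambda * h s)%:E <=
   \int[lebesgue_measure]_s (w s * expR (lambda * h s / w s) +
     k * (lambda * tau) * w s)%:E)%E.
  apply: ge0_le_integral => //.
  - by move=> s _; rewrite lee_fin addr_ge0// ?mulr_ge0// ltW.
  - apply/measurable_EFinP; apply: measurable_funD; first exact: measurable_funM.
    exact: measurable_funM.
  - apply/measurable_EFinP; apply: measurable_funD => //; exact: measurable_funM.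
  move=> s _; rewrite lee_fin.
  set x := lambda * h s / w s.
  have : w s * ((1 + (x - lambda * tau)) * k) <= w s * expR x.
    by rewrite ler_pM2l// -ler_pdivlMr ?expR_gt0// -expRB expR_ge1Dx.
  rewrite (_ : w s * (_ * k) =
    w s * k + k * lambda * h s - k * (lambda * tau) * w s); first lra.
  by rewrite /x; field; rewrite gt_eqF.
have mWk : measurable_fun setT (fun s => (w s * k)%:E).
  by apply/measurable_EFinP; exact: measurable_funM.
have mkh : measurable_fun setT (fun s => (k * lambda * h s)%:E).
  by apply/measurable_EFinP; exact: measurable_funM.
have mkw : measurable_fun setT (fun s => (k * (lambda * tau) * w s)%:E).
  by apply/measurable_EFinP; exact: measurable_funM.
have klt : (0 <= (k * (lambda * tau))%:E)%E by rewrite lee_fin !mulr_ge0.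
move: lin; under eq_integral do rewrite EFinD.
rewrite ge0_integralD//; last 2 first.
- by move=> s _; rewrite lee_fin mulr_ge0// ltW.
- by move=> s _; rewrite lee_fin !mulr_ge0.
under [X in (_ <= X)%E -> _]eq_integral do rewrite EFinD.
rewrite ge0_integralD//; last 3 first.
- by move=> s _; rewrite lee_fin mulr_ge0 ?expR_ge0// ltW.
- exact/measurable_EFinP.
- by move=> s _; rewrite lee_fin mulr_ge0 ?mulr_ge0// ltW.
under eq_integral do rewrite mulrC EFinM.
rewrite ge0_integralZl//; last 2 first.
- exact/measurable_EFinP.
- by move=> s _; rewrite lee_fin ltW.
rewrite w1 mule1.
under [X in (_ + X <= _)%E -> _]eq_integral do rewrite EFinM.
rewrite ge0_integralZl//; last 3 first.
- exact/measurable_EFinP.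
- by move=> s _; rewrite lee_fin.
- by rewrite lee_fin mulr_ge0.
under [X in (_ <= _ + X)%E -> _]eq_integral do rewrite EFinM.
rewrite ge0_integralZl//; last 2 first.
- exact/measurable_EFinP.
- by move=> s _; rewrite lee_fin ltW.
rewrite w1 mule1 => H.
(* The term moved across is finite, so it cancels even in the extended reals. *)
rewrite -(leeD2rE (x := (k * (lambda * tau))%:E))//.
apply: le_trans H; rewrite leeD2l// mulrA EFinM.
by rewrite lee_wpmul2l// lee_fin mulr_ge0.
Qed.

(** * Exponential bounds at a fixed level *)

(** With [y = 2 + u ^+ 2 / 2] the tail is [e^(2 - y)]. Since [b <= 1 / 4], [e^a] costs at most
    [e^(y / 4)], and what remains is [b ^+ 2] times the square of [y e^(1 - 3 y / 8)]. *)
Lemma gaussian_tail_expR_le {R : realType} (a b u : R) :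
  0 <= b <= 1 / 4 -> 0 <= a <= b * (2 + u ^+ 2 / 2) ->
  expR (- (u ^+ 2 / 2)) * (a ^+ 2 * expR a) <= 64 / 9 * b ^+ 2.
Proof.
move=> /andP[b0 b4] /andP[a0].
set y := 2 + u ^+ 2 / 2 => ay.
have y2 : 2 <= y by rewrite /y; have := sqr_ge0 u; lra.
have ay4 : a <= y / 4 by nra.
apply: (@le_trans _ _ ((b * y) ^+ 2 * expR (2 - 3 / 4 * y))).
  rewrite mulrCA -expRD ler_pM ?sqr_ge0 ?expR_ge0//.
    by rewrite lerXn2r// nnegrE mulr_ge0//; lra.
  by rewrite ler_expR /y; rewrite /y in ay4; lra.
(* This is [z e^(1 - z) <= 1] at [z = 3 y / 8]. *)
have h : y * expR (1 - 3 / 8 * y) <= 8 / 3.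
  have e1 : expR (3 / 8 * y - 1) * expR (1 - 3 / 8 * y) = 1.
    by rewrite -expRD (_ : _ + _ = 0) ?expR0//; ring.
  have := expR_ge1Dx (3 / 8 * y - 1).
  rewrite -(ler_pM2r (expR_gt0 (1 - 3 / 8 * y))) e1; lra.
rewrite (_ : expR _ = expR (1 - 3 / 8 * y) ^+ 2); last first.
  by rewrite -expRM_natl; congr expR; lra.
rewrite (_ : _ * _ = b ^+ 2 * (y * expR (1 - 3 / 8 * y)) ^+ 2); last by ring.
rewrite mulrC ler_wpM2r ?sqr_ge0// (_ : 64 / 9 = (8 / 3) ^+ 2); last by field.
rewrite lerXn2r// nnegrE ?mulr_ge0 ?expR_ge0//; lra.
Qed.

Lemma rcdf_tail_le {d} {T : measurableType d} {R : realType}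
    (P : probability T R) (X : {RV P >-> R}) (sigma s : R) :
  sub_gaussian X sigma ->
  Num.min (rcdf X s) (1 - rcdf X s) <= expR (- (s ^+ 2 / (2 * sigma ^+ 2))).
Proof.
move=> Xsub.
have cdfE : (rcdf X s)%:E = P [set w | X w <= s].
  by rewrite /rcdf fineK ?fin_num_measure//.
have mXs : measurable [set w | X w <= s].
  rewrite (_ : mkset _ = setT `&` X @^-1` `]-oo, s]%classic).
    exact: (measurable_funPT X).
  by apply/seteqP; split => w; rewrite /= in_itv//= => -[].
have [s0|s0|->] := ltgtP s 0.
- rewrite ge_min; apply/orP; left; rewrite -lee_fin cdfE.
  have [_] := Xsub (- s) ltac:(by rewrite oppr_gt0).
  by rewrite opprK sqrrN.
- rewrite ge_min; apply/orP; right; rewrite -lee_fin.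
  have [+ _] := Xsub s s0; apply: le_trans.
  rewrite EFinB cdfE -(probability_setC P mXs) //.
  apply: le_measure; rewrite ?inE//.
  + exact: measurableC.
  + rewrite (_ : mkset _ = setT `&` X @^-1` `[s, +oo[%classic).
      exact: (measurable_funPT X).
    by apply/seteqP; split => w; rewrite /= in_itv/= andbT// => -[].
  by move=> w /= /negP; rewrite -ltNge => /ltW.
(* The sub-Gaussian bounds concern positive [eps] only; at [s = 0] the right-hand side is 1. *)
rewrite expr0n/= mul0r oppr0 expR0 ge_min.
by have /andP[_ ->] := cdf_bounds (rcdf X : CDF R) 0.
Qed.

(** The factor 2 comes from [e^|x| <= e^x + e^(-x)]. The negated deviation is the centred sum of the
    complementary events []s, +oo[], so [integral_expR_sum_le] covers both terms with the same
    [q]. *)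
Lemma integral_ecdf_deviation_le {d} {T : measurableType d} {R : realType}
    (P : probability T R) (X : {RV P >-> R}) (n : nat) (n_gt0 : (0 < n)%N)
    (Xs : 'I_n -> {RV P >-> R}) (a q s : R) :
  iid_samples X Xs -> 0 <= a ->
  Num.min (rcdf X s) (1 - rcdf X s) <= q ->
  (\int[P]_w (expR (a * (n%:R * `|ecdf n_gt0 (Xs ^~ w) s - rcdf X s|)))%:E <=
   (2 * expR (n%:R * (q * (a ^+ 2 * expR a))))%:E)%E.
Proof.
move=> [indep same] a0 pq.
set p := rcdf X s.
have p01 : 0 <= p <= 1 := cdf_bounds (rcdf X : CDF R) s.
have PL i : P (Xs i @^-1` `]-oo, s]) = p%:E.
  rewrite -[LHS]/(distribution P (Xs i) _) same// /p /rcdf fineK//.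
  exact: fin_num_measure.
have PG i : P (Xs i @^-1` `]s, +oo[) = (1 - p)%:E.
  rewrite -setCitvl preimage_setC probability_setC ?PL//.
  rewrite -[X in measurable X]setTI.
  exact: (measurable_funPT (Xs i) measurableT _ (measurable_itv `]-oo, s])).
have n0 : n%:R != 0 :> R by rewrite pnatr_eq0 -lt0n.
have dev w : n%:R * (ecdf n_gt0 (Xs ^~ w) s - p) =
    \sum_i (\1_(`]-oo, s]%classic) (Xs i w) - p).
  rewrite mulrBr /ecdf mulVKf// sumrB sumr_const card_ord mulr_natl.
  congr (_ - _); apply: eq_bigr => i _.
  by rewrite indicE mem_setE in_itv.
have devN w : - (n%:R * (ecdf n_gt0 (Xs ^~ w) s - p)) =
    \sum_i (\1_(`]s, +oo[%classic) (Xs i w) - (1 - p)).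
  rewrite dev -sumrN; apply: eq_bigr => i _.
  rewrite !indicE !mem_setE !in_itv/= andbT ltNge.
  by case: leP => _ /=; ring.
have mexp (B : set R) c : measurable B -> measurable_fun setT
    (fun w => (expR (a * (\sum_i (\1_B (Xs i w) - c))))%:E).
  move=> mB; apply/measurable_EFinP; apply: measurableT_comp => //.
  apply: measurable_funM => //; apply: measurable_sum => i.
  apply: measurable_funB => //.
  by apply: measurableT_comp => //; exact: measurable_indic.
have absE w : n%:R * `|ecdf n_gt0 (Xs ^~ w) s - p| =
    `|\sum_i (\1_(`]-oo, s]%classic) (Xs i w) - p)|.
  by rewrite -dev normrM ger0_norm.
under eq_integral do rewrite absE.
apply: (@le_trans _ _ (\int[P]_w
   ((expR (a * (\sum_i (\1_(`]-oo, s]%classic) (Xs i w) - p))))%:E +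
    (expR (a * (\sum_i (\1_(`]s, +oo[%classic) (Xs i w) - (1 - p)))))%:E))%E).
  apply: ge0_le_integral => //.
  - apply/measurable_EFinP; apply: measurableT_comp => //.
    apply: measurable_funM => //; apply: measurableT_comp => //.
    apply: measurable_sum => i; apply: measurable_funB => //.
    by apply: measurableT_comp => //; exact: measurable_indic.
  - by apply: emeasurable_funD; exact: mexp.
  move=> w _; rewrite -dev -devN -EFinD lee_fin.
  set x := n%:R * _.
  have [x0|x0] := ger0P x; first by rewrite lerDl expR_ge0.
  by rewrite lerDr expR_ge0.
rewrite ge0_integralD//; [|exact: mexp|exact: mexp].
rewrite mulr_natl mulr2n EFinD; apply: leeD.
  exact: integral_expR_sum_le.
apply: integral_expR_sum_le => //.
  by move: p01; lra.
by rewrite (_ : 1 - (1 - p) = p); [rewrite minC|ring].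
Qed.

(** * Deviation probability of the integral *)

Lemma measurable_ecdf_uncurry {d} {T : measurableType d} {R : realType} (n : nat)
    (n_gt0 : (0 < n)%N) (X : 'I_n -> T -> R) :
  (forall i, measurable_fun setT (X i)) ->
  measurable_fun setT (fun z : T * measurableTypeR R => ecdf n_gt0 (X ^~ z.1) z.2).
Proof.
move=> mX; apply: measurable_funM => //; apply: measurable_sum => i.
apply: measurable_natr_ler; last exact: measurable_snd.
exact: (measurableT_comp (mX i) measurable_fst).
Qed.

(** Markov's inequality for the exponential, with Jensen's bound and Tonelli. The free parameter [b]
    is the exponential tilt made scale-free. *)
Lemma prob_ecdf_deviation_le {d} {T : measurableType d} {R : realType}
    (P : probability T R) (X : {RV P >-> R}) (sigma : R) (n : nat)
    (n_gt0 : (0 < n)%N) (Xs : 'I_n -> {RV P >-> R}) (b tau : R) (A : set T) :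
  0 < sigma -> sub_gaussian X sigma -> iid_samples X Xs ->
  0 <= b <= 1 / 4 -> 0 <= tau -> measurable A ->
  (forall w, A w -> tau%:E <=
     \int[lebesgue_measure]_s `|ecdf n_gt0 (Xs ^~ w) s - rcdf X s|%:E)%E ->
  (P A <= (2 * expR (n%:R * (64 / 9 * b ^+ 2) - n%:R * b / (4 * sigma) * tau))%:E)%E.
Proof.
move=> s0 Xsub Xiid b14 t0 mA Atau.
have /andP[b0 _] := b14.
have c0 : 0 < 2 * sigma by rewrite mulr_gt0.
pose w := weight (2 * sigma).
have w0 s : 0 < w s by exact: weight_gt0.
have mw : measurable_fun setT w.
  by apply: continuous_measurable_fun; exact: continuous_weight.
have mwV : measurable_fun setT (fun s => (w s)^-1).
  apply: continuous_measurable_fun => s; apply: cvgV; first by rewrite gt_eqF.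
  exact: continuous_weight.
(* Chosen so that [lambda / (n w(s))] equals [b (2 sigma + |s|)^2 / (4 sigma^2)], which is at most
   [b (2 + u^2 / 2)] for [u = s / sigma], as [gaussian_tail_expR_le] requires. *)
pose lambda := n%:R * b / (4 * sigma).
have l0 : 0 <= lambda by rewrite divr_ge0 ?mulr_ge0// ltW.
pose h om s := `|ecdf n_gt0 (Xs ^~ om) s - rcdf X s|.
pose G (z : T * measurableTypeR R) : \bar R :=
  (w z.2 * expR (lambda * h z.1 z.2 / w z.2))%:E.
have mh2 : measurable_fun setT (fun z : T * measurableTypeR R => h z.1 z.2).
  apply: measurableT_comp => //; apply: measurable_funB.
    exact: (measurable_ecdf_uncurry n n_gt0 (fun i => Xs i)
      (fun i => measurable_funPT (Xs i))).
  exact: (measurableT_comp (measurable_cdf (rcdf X : CDF R)) measurable_snd).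
have mG : measurable_fun setT G.
  apply/measurable_EFinP; apply: measurable_funM.
    exact: (measurableT_comp mw measurable_snd).
  apply: measurableT_comp => //; apply: measurable_funM.
    exact: measurable_funM.
  exact: (measurableT_comp mwV measurable_snd).
have G0 z : (0 <= G z)%E by rewrite lee_fin mulr_ge0 ?expR_ge0// ltW.
set K := 2 * expR (n%:R * (64 / 9 * b ^+ 2)).
have mGF := @measurable_fun_fubini_tonelli_F _ _ T (measurableTypeR R) R
  lebesgue_measure G mG G0.
have mGG := @measurable_fun_fubini_tonelli_G _ _ T (measurableTypeR R) R P G mG G0.
have key : ((expR (lambda * tau))%:E * P A <= K%:E)%E.
  apply: (@le_trans _ _ (\int[P]_om \int[lebesgue_measure]_s G (om, s))%E).
    rewrite -integral_cst//.
    apply: (@le_trans _ _ (\int[P]_(om in A) \int[lebesgue_measure]_s G (om, s))%E).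
      apply: ge0_le_integral => //.
      - by move=> om _; rewrite lee_fin expR_ge0.
      - exact: measurable_funTS.
      move=> om Aom; apply: expR_le_integral_weight => //.
      - apply: measurableT_comp => //; apply: measurable_funB.
          exact: (measurable_cdf (ecdf n_gt0 (Xs ^~ om) : CDF R)).
        exact: (measurable_cdf (rcdf X : CDF R)).
      - by move=> s; exact: normr_ge0.
      - exact: integral_weight.
      - exact: Atau.
    apply: ge0_subset_integral => //.
    by move=> om _; exact: integral_ge0.
  rewrite fubini_tonelli//.
  (* At each [s] the expectation of the exponential is at most [K]; as [w] has mass 1, so is the
     whole integral. *)
  apply: (@le_trans _ _ (\int[lebesgue_measure]_s (K%:E * (w s)%:E))%E); last first.
    rewrite ge0_integralZl//.
    - by rewrite integral_weight// mule1.
    - exact/measurable_EFinP.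
    - by move=> s _; rewrite lee_fin ltW.
    - by rewrite lee_fin mulr_ge0 ?expR_ge0.
  apply: ge0_le_integral => //.
  - by move=> s _; exact: integral_ge0.
  - by apply/measurable_EFinP; exact: measurable_funM.
  move=> s _; rewrite /G/=.
  under eq_integral do rewrite EFinM.
  rewrite ge0_integralZl//; last 2 first.
  - apply/measurable_EFinP.
    pose pair (om : T) : T * measurableTypeR R := (om, s).
    have mpair : measurable_fun setT pair by exact: measurable_pair2.
    apply: measurableT_comp => //; apply: measurable_funM => //.
    apply: measurable_funM => //; exact: (measurableT_comp mh2 mpair).
  - by rewrite lee_fin ltW.
  rewrite muleC lee_wpmul2r// ?lee_fin ?(ltW (w0 s))//.
  pose a := b / (4 * sigma) / w s.
  have a0 : 0 <= a.
    have s40 : 0 < 4 * sigma by rewrite mulr_gt0.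
    exact: divr_ge0 (divr_ge0 b0 (ltW s40)) (ltW (w0 s)).
  have aE om : lambda * h om s / w s = a * (n%:R * h om s).
    by rewrite /a /lambda; ring.
  under eq_integral do rewrite aE.
  apply: (le_trans (integral_ecdf_deviation_le P X n n_gt0 Xs a _ s Xiid a0
    (rcdf_tail_le P X sigma s Xsub))).
  rewrite lee_fin ler_wpM2l// ler_expR ler_wpM2l//.
  rewrite (_ : s ^+ 2 / (2 * sigma ^+ 2) = (s / sigma) ^+ 2 / 2); last first.
    by field; rewrite gt_eqF.
  apply: gaussian_tail_expR_le => //; rewrite a0/= /a /w /weight.
  rewrite (_ : b / (4 * sigma) / _ =
      b * ((2 * sigma + `|s|) ^+ 2 / (4 * sigma ^+ 2))); last first.
    by field; rewrite !gt_eqF// ltr_wpDr// mulr_gt0.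
  rewrite ler_wpM2l// ler_pdivrMr ?mulr_gt0 ?exprn_gt0//.
  rewrite (_ : _ * (4 * _) = 8 * sigma ^+ 2 + 2 * `|s| ^+ 2); last first.
    by rewrite real_normK ?num_real//; field; rewrite gt_eqF.
  have := sqr_ge0 (2 * sigma - `|s|); lra.
rewrite -(@lee_pmul2l _ (expR (lambda * tau))%:E) ?lte_fin ?expR_gt0//.
apply: (le_trans key); rewrite -EFinM lee_fin /K [leRHS]mulrCA -expRD.
by rewrite [lambda * tau + _](_ : _ = n%:R * (64 / 9 * b ^+ 2)) ?lexx// /lambda; ring.
Qed.

(** * Numerical constants and conclusion *)

(** Eighth powers of [1 + x <= expR x] at [x = 1 / 8] and [x = - 1 / 8]. The lower bound yields
    [256 e >= 640], the upper one controls the square root of [e]. *)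
Lemma expR1_bounds {R : realType} : 5 / 2 <= (expR 1 : R) <= 3.
Proof.
have e8 (x : R) : expR x = expR (x / 8) ^+ 8.
  by rewrite -expRM_natl; congr expR; field.
have h1 : 9 / 8 <= expR (1 / 8) :> R.
  by apply: le_trans (expR_ge1Dx _); lra.
have h2 : 7 / 8 <= expR (- 1 / 8) :> R.
  by apply: le_trans (expR_ge1Dx _); lra.
apply/andP; split.
  rewrite e8; apply: (@le_trans _ _ ((9 / 8) ^+ 8)); first by lra.
  by rewrite lerXn2r// nnegrE ?expR_ge0//; lra.
have : (7 / 8) ^+ 8 <= expR (- 1) :> R.
  by rewrite e8 lerXn2r// nnegrE ?expR_ge0//; lra.
have : expR 1 * expR (- 1) = 1 :> R by rewrite -expRD subrr expR0.
have := expR_gt0 (1 : R); have := expR_gt0 (- 1 : R).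
nra.
Qed.

(* With this b the exponent is (x + 1)^2 / 2025 - (x + 1) (x + 512) / 480, and
   1 / 480 - 1 / 2025 > 1 / 640 > 1 / (256 e). *)
Lemma deviation_exponent_le {R : realType} (x r sigma t tau : R) :
  let b := (x + 1) / (120 * r) in
  0 < sigma -> 1 <= r -> 0 <= x -> x < 16 * r * Num.sqrt (expR 1) ->
  x = r * t / sigma -> tau = t + 512 * sigma / r ->
  0 <= b <= 1 / 4 /\
  2 * expR (r ^+ 2 * (64 / 9 * b ^+ 2) - r ^+ 2 * b / (4 * sigma) * tau) <=
  expR (- (r ^+ 2 / (256 * sigma ^+ 2 * expR 1) * t ^+ 2)).
Proof.
move=> b s0 r1 x0 xlt xE tauE.
have r0 : 0 < r by exact: lt_le_trans r1.
have /andP[e52 e3] := @expR1_bounds R.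
(* Hence [x < 29 r], so [x + 1 <= 30 r] because [r >= 1], which is exactly [b <= 1 / 4]. *)
have sqe : Num.sqrt (expR 1) <= 29 / 16 :> R.
  rewrite -(@ler_pXn2r _ 2)// ?nnegrE ?sqrtr_ge0//.
  rewrite sqr_sqrtr ?expR_ge0//; lra.
have xr : x + 1 <= 30 * r by nra.
split.
  rewrite /b divr_ge0/=; [|lra..].
  by rewrite ler_pdivrMr ?mulr_gt0//; lra.
(* The factor 2 adds at most 1 to the exponent. The part [512 (x + 1) / 480] pays for it even at
   [x = 0], thanks to [x + 1] rather than [x] in [b]. *)
have e2 : 2 <= expR 1 :> R by lra.
apply: (@le_trans _ _ (expR (1 +
    (r ^+ 2 * (64 / 9 * b ^+ 2) - r ^+ 2 * b / (4 * sigma) * tau)))).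
  by rewrite [leRHS]expRD ler_wpM2r ?expR_ge0.
rewrite ler_expR.
have tE : t = x * sigma / r by rewrite xE; field; rewrite !gt_eqF.
rewrite (_ : r ^+ 2 * (64 / 9 * b ^+ 2) = (x + 1) ^+ 2 / 2025); last first.
  by rewrite /b; field; rewrite gt_eqF.
rewrite (_ : r ^+ 2 * b / (4 * sigma) * tau = (x + 1) * (x + 512) / 480); last first.
  by rewrite /b tauE tE; field; rewrite !gt_eqF.
rewrite (_ : r ^+ 2 / _ * _ = x ^+ 2 / (256 * expR 1)); last first.
  by rewrite tE; field; rewrite !gt_eqF ?expR_gt0.
have : x ^+ 2 / (256 * expR 1) <= x ^+ 2 / 640.
  by rewrite ler_wpM2l ?sqr_ge0// lef_pV2 ?posrE; lra.
have := sqr_ge0 x; rewrite !expr2; nra.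
Qed.

Theorem theorem27 (R : realType) (d : measure_display) (T : measurableType d)
    (P : probability T R) (X : {RV P >-> R}) (sigma : R) (sigma_gt0 : 0 < sigma)
    (X_subG : sub_gaussian X sigma)
    (rho : CDF R -> R) (L kappa : R) (L_gt0 : 0 < L)
    (kappa_gt0 : 0 < kappa) (kappa_le1 : kappa <= 1)
    (rho_T1 : risk_type_T1 rho L kappa)
    (n : nat) (n_gt0 : (0 < n)%N)
    (Xs : 'I_n -> {RV P >-> R}) (Xs_iid : iid_samples X Xs)
    (eps : R) (eps_gt0 : 0 < eps)
    (eps_lower : 512 * sigma / Num.sqrt n%:R < (eps / L) `^ (kappa^-1))
    (eps_upper : (eps / L) `^ (kappa^-1) <
       512 * sigma / Num.sqrt n%:R + 16 * sigma * Num.sqrt (expR 1)) :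
  (P [set w | (eps < `|rho (ecdf n_gt0 (fun i => Xs i w)) - rho (rcdf X)|)%R] <=
   (expR (- (n%:R / (256 * sigma ^+ 2 * expR 1) *
     ((eps / L) `^ (kappa^-1) - 512 * sigma / Num.sqrt n%:R) ^+ 2)))%:E)%E.
Proof.
set r := Num.sqrt n%:R in eps_lower eps_upper *.
set tau := (eps / L) `^ kappa^-1 in eps_lower eps_upper *.
have r1 : 1 <= r by rewrite -[1]sqrtr1 ler_wsqrtr// ler1n.
have r0 : 0 < r by exact: lt_le_trans r1.
have rn : r ^+ 2 = n%:R by rewrite sqr_sqrtr.
pose t := tau - 512 * sigma / r.
have t0 : 0 < t by rewrite subr_gt0.
(* Scale-free excess over the shift: expressed in [x], the final comparison of exponents involves
   neither [sigma] nor [n]. *)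
pose x := r * t / sigma.
have x0 : 0 <= x by rewrite /x divr_ge0 ?mulr_ge0 ?ltW.
have xlt : x < 16 * r * Num.sqrt (expR 1).
  rewrite /x ltr_pdivrMr// (_ : _ * sigma = r * (16 * sigma * Num.sqrt (expR 1))).
    by rewrite ltr_pM2l// /t; lra.
  by ring.
have tauE : tau = t + 512 * sigma / r by rewrite /t subrK.
have [b14 expo] := deviation_exponent_le x r sigma t tau sigma_gt0 r1 x0 xlt erefl tauE.
have mA := measurable_risk_gap rho L kappa (rcdf X) eps n n_gt0 (fun i => Xs i)
  L_gt0 kappa_gt0 rho_T1 (fun i => measurable_funPT (Xs i)).
apply: (le_trans (prob_ecdf_deviation_le P X sigma n n_gt0 Xs _ tau _ sigma_gt0
  X_subG Xs_iid b14 (powR_ge0 _ _) mA _)) => [w Aw|].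
  exact/ltW/(risk_type_T1_gap _ _ _ _ _ _ L_gt0 kappa_gt0 rho_T1 eps_gt0 Aw).
by rewrite lee_fin -rn.
Qed.
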